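(* Let $p\ge5$ be a prime with Legendre symbol $\left(\frac{-18}{p}\right)=-1$, and let $m\ge0$, $\alpha\ge0$, $n\ge0$ be integers. Then for every $i\in\{1,2,\dots,p-1\}$, $$\overline{S}_9^{\,16m+1}\big(24p^{2\alpha+2}n+(24i+11p)p^{2\alpha+1}\big)\equiv0\pmod{32}.$$
   Context: For $|q|<1$ and a positive integer $k$, write $f_k=\prod_{j\ge1}(1-q^{kj})$. For a positive integer $r$, $\overline{S}_9^{\,r}(n)$ (number of $9$-Schur overpartitions of $n$ with $r$-tuples) is defined by $\sum_{n\ge0}\overline{S}_9^{\,r}(n)q^n=\prod_{n\ge1}\frac{(1+q^{2n-1})^r(1-q^{9(2n-1)})^r}{(1+q^{9(2n-1)})^r(1-q^{2n-1})^r}=\frac{f_2^{3r}f_9^{2r}f_{36}^r}{f_1^{2r}f_4^rf_{18}^{3r}}$. *)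

(* Defs.v *)
From HB Require Import structures.
From mathcomp Require Import all_boot all_order all_algebra.
From mathcomp Require Import boolp classical_sets.

Set Implicit Arguments.
Unset Strict Implicit.
Unset Printing Implicit Defensive.

Import Order.TTheory GRing.Theory Num.Theory.
Local Open Scope ring_scope.

(* Formal power series: [a n] is the coefficient of q^n. The wrapper record
   keeps the Cauchy product apart from the pointwise ring of functions. *)
Record fps (R : Type) := Fps { fps_coef :> nat -> R }.

HB.instance Definition _ (R : Type) := gen_eqMixin (fps R).
HB.instance Definition _ (R : Type) := gen_choiceMixin (fps R).

Lemma fpsP (R : Type) (a b : fps R) : (forall n, a n = b n) -> a = b.
Proof. by case: a b => [a] [b] /= ab; congr Fps; apply/funext. Qed.

Definition fps_zero (R : nmodType) : fps R := Fps (fun=> 0).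
Definition fps_opp (R : zmodType) (a : fps R) : fps R := Fps (fun n => - a n).
Definition fps_add (R : nmodType) (a b : fps R) : fps R :=
  Fps (fun n => a n + b n).
Definition fps_one (R : pzSemiRingType) : fps R := Fps (fun n => (n == 0%N)%:R).
Definition fps_mul (R : pzSemiRingType) (a b : fps R) : fps R :=
  Fps (fun n => \sum_(i < n.+1) a i * b (n - i)%N).

Lemma fps_addA (R : zmodType) : associative (@fps_add R).
Proof. by move=> a b c; apply: fpsP => n /=; rewrite addrA. Qed.
Lemma fps_addC (R : zmodType) : commutative (@fps_add R).
Proof. by move=> a b; apply: fpsP => n /=; rewrite addrC. Qed.
Lemma fps_add0 (R : zmodType) : left_id (@fps_zero R) (@fps_add R).
Proof. by move=> a; apply: fpsP => n /=; rewrite add0r. Qed.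
Lemma fps_addN (R : zmodType) :
  left_inverse (@fps_zero R) (@fps_opp R) (@fps_add R).
Proof. by move=> a; apply: fpsP => n /=; rewrite addNr. Qed.

HB.instance Definition _ (R : zmodType) := GRing.isZmodule.Build (fps R)
  (@fps_addA R) (@fps_addC R) (@fps_add0 R) (@fps_addN R).

Definition fps_trunc (R : nzRingType) (n : nat) (a : fps R) : {poly R} :=
  \poly_(i < n.+1) a i.

Lemma coef_fps_trunc (R : nzRingType) n (a : fps R) i :
  (i <= n)%N -> (fps_trunc n a)`_i = a i.
Proof. by move=> le_in; rewrite coef_poly ltnS le_in. Qed.

Lemma coef_fps_truncM (R : nzRingType) n (a b : fps R) m :
  (m <= n)%N -> (fps_trunc n a * fps_trunc n b)`_m = fps_mul a b m.
Proof.
move=> le_mn; rewrite coefM /=; apply: eq_bigr => i _.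
rewrite !coef_fps_trunc //; first exact: leq_trans (leq_subr _ _) le_mn.
by apply: leq_trans le_mn; rewrite -ltnS.
Qed.

Lemma fps_mulA (R : comNzRingType) : associative (@fps_mul R).
Proof.
move=> a b c; apply: fpsP => n.
transitivity ((fps_trunc n a * (fps_trunc n b * fps_trunc n c))`_n).
  rewrite coefM /=; apply: eq_bigr => i _.
  by rewrite coef_fps_truncM ?leq_subr // coef_fps_trunc // -ltnS.
rewrite mulrA coefM /=; apply: eq_bigr => i _.
by rewrite coef_fps_truncM -1?ltnS // coef_fps_trunc ?leq_subr.
Qed.
Lemma fps_mulC (R : comNzRingType) : commutative (@fps_mul R).
Proof.
move=> a b; apply: fpsP => n.
by rewrite -!(@coef_fps_truncM R n) // mulrC.
Qed.
Lemma fps_mul1 (R : comNzRingType) : left_id (@fps_one R) (@fps_mul R).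
Proof.
move=> a; apply: fpsP => n /=.
rewrite big_ord_recl /= mul1r subn0 big1 ?addr0 // => i _.
by rewrite /= mul0r.
Qed.
Lemma fps_mulDl (R : comNzRingType) :
  left_distributive (@fps_mul R) (@fps_add R).
Proof.
move=> a b c; apply: fpsP => n /=; rewrite -big_split /=.
by apply: eq_bigr => i _; rewrite mulrDl.
Qed.
Lemma fps_one_neq0 (R : comNzRingType) : fps_one R != 0 :> fps R.
Proof.
apply/eqP => /(congr1 (fun a : fps R => a 0%N)) /= /eqP.
by rewrite oner_eq0.
Qed.

HB.instance Definition _ (R : comNzRingType) :=
  GRing.Zmodule_isComNzRing.Build (fps R) (@fps_mulA R) (@fps_mulC R)
    (@fps_mul1 R) (@fps_mulDl R) (@fps_one_neq0 R).

Lemma fps_coef0 (R : comNzRingType) n : (0 : fps R) n = 0. Proof. by []. Qed.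
Lemma fps_coef1 (R : comNzRingType) n : (1 : fps R) n = (n == 0%N)%:R.
Proof. by []. Qed.
Lemma fps_coefN (R : comNzRingType) (a : fps R) n : (- a) n = - a n.
Proof. by []. Qed.
Lemma fps_coefD (R : comNzRingType) (a b : fps R) n : (a + b) n = a n + b n.
Proof. by []. Qed.
Lemma fps_coefM (R : comNzRingType) (a b : fps R) n :
  (a * b) n = \sum_(i < n.+1) a i * b (n - i)%N.
Proof. by []. Qed.
Lemma fps_coefM0 (R : comNzRingType) (a b : fps R) :
  (a * b) 0%N = a 0%N * b 0%N.
Proof. by rewrite fps_coefM big_ord1. Qed.

Definition fpsC (R : nmodType) (c : R) : fps R :=
  Fps (fun n => if n == 0%N then c else 0).
Definition fpsX (R : pzSemiRingType) : fps R := Fps (fun n => (n == 1%N)%:R).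

Lemma fps_coefCM (R : comNzRingType) (c : R) (a : fps R) n :
  (fpsC c * a) n = c * a n.
Proof.
rewrite fps_coefM big_ord_recl /= subn0 big1 ?addr0 // => i _.
by rewrite /= mul0r.
Qed.

Lemma fps_coefXM (R : comNzRingType) (a : fps R) n :
  (fpsX R * a) n = if n is m.+1 then a m else 0.
Proof.
case: n => [|n]; first by rewrite fps_coefM0 /= mul0r.
rewrite fps_coefM big_ord_recl /= mul0r add0r big_ord_recl /= mul1r.
rewrite subSS subn0 big1 ?addr0 // => i _.
by rewrite /= mul0r.
Qed.

Lemma fps_coefXn (R : comNzRingType) k n : (fpsX R ^+ k) n = (n == k)%:R.
Proof.
elim: k n => [|k IHk] n; first by rewrite expr0.
by rewrite exprS fps_coefXM; case: n => [//|n]; rewrite IHk eqSS.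
Qed.

Lemma fps_expr_eq0 (R : comNzRingType) (u : fps R) k n :
  u 0%N = 0 -> (n < k)%N -> (u ^+ k) n = 0.
Proof.
move=> u0; elim: k n => // k IHk n lt_nk.
rewrite exprS fps_coefM big_ord_recl u0 mul0r add0r big1 // => i _.
rewrite IHk ?mulr0 //; move: lt_nk; rewrite /= /bump /= add1n.
case: n i => [[]//|n i]; rewrite !ltnS subSS => le_nk.
exact: leq_ltn_trans (leq_subr _ _) le_nk.
Qed.

(* A series is a unit iff its constant coefficient is; then
   a = a_0 (1 - u) with u_0 = 0, and 1 / a = a_0^-1 (1 + u + u^2 + ...),
   in which only the terms u^k with k <= n reach the coefficient of q^n. *)
Definition fps_unit (R : comUnitRingType) : {pred fps R} :=
  fun a => a 0%N \is a GRing.unit.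
Definition fps_inv (R : comUnitRingType) (a : fps R) : fps R :=
  if a 0%N \is a GRing.unit then
    Fps (fun n => (a 0%N)^-1 *
                  (\sum_(k < n.+1) (1 - fpsC (a 0%N)^-1 * a) ^+ k) n)
  else a.

Lemma fps_coef_sum (R : comNzRingType) I (r : seq I) (P : pred I)
    (F : I -> fps R) n :
  (\sum_(i <- r | P i) F i) n = \sum_(i <- r | P i) F i n.
Proof. exact: (big_morph (fun a : fps R => a n)). Qed.

Lemma fps_mulVx (R : comUnitRingType) :
  {in @fps_unit R, left_inverse 1 (@fps_inv R) *%R}.
Proof.
move=> a; rewrite unfold_in => a0U; rewrite /fps_inv ifT //.
set c := (a 0%N)^-1; set u : fps R := 1 - fpsC c * a.
have u0 : u 0%N = 0.
  by rewrite /u fps_coefD fps_coefN fps_coefCM mulVr // subrr.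
set v : fps R := Fps _; apply: fpsP => n.
have vE i : (i <= n)%N -> v i = (fpsC c * \sum_(k < n.+1) u ^+ k) i.
  move=> le_in; rewrite fps_coefCM /v /=; congr (_ * _).
  rewrite !fps_coef_sum.
  rewrite -!(big_mkord xpredT (fun k => (u ^+ k) i)).
  rewrite [RHS](@big_cat_nat _ _ _ i.+1) //=.
  rewrite [X in _ = _ + X]big_nat_cond [X in _ = _ + X]big1 ?addr0 // => k.
  by rewrite andbT => /andP[lt_ik _]; rewrite fps_expr_eq0.
transitivity ((fpsC c * (\sum_(k < n.+1) u ^+ k) * a) n).
  by rewrite !fps_coefM; apply: eq_bigr => i _; rewrite vE // -ltnS.
have -> : fpsC c * (\sum_(k < n.+1) u ^+ k) * a = 1 - u ^+ n.+1.
  rewrite -[RHS]opprB subrX1 -mulNr opprB [in RHS]/u subKr.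
  by rewrite mulrAC.
by rewrite fps_coefD fps_coefN fps_expr_eq0 // subr0.
Qed.

Lemma fps_unitPl (R : comUnitRingType) (a b : fps R) :
  b * a = 1 -> fps_unit a.
Proof.
move=> /(congr1 (fun x : fps R => x 0%N)); rewrite fps_coefM0 fps_coef1 => ba.
by apply/unitrPr; exists (b 0%N); rewrite mulrC.
Qed.

Lemma fps_inv_out (R : comUnitRingType) :
  {in [predC @fps_unit R], @fps_inv R =1 id}.
Proof.
by move=> a; rewrite inE unfold_in /fps_inv => /negbTE ->.
Qed.

HB.instance Definition _ (R : comUnitRingType) :=
  GRing.ComNzRing_hasMulInverse.Build (fps R)
    (@fps_mulVx R) (@fps_unitPl R) (@fps_inv_out R).

Lemma fps_unitE (R : comUnitRingType) (a : fps R) :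
  (a \is a GRing.unit) = (a 0%N \is a GRing.unit).
Proof. by []. Qed.

(* Convergence in the q-adic topology. *)
Definition fps_cvg (R : Type) (u : nat -> fps R) (l : fps R) : Prop :=
  forall n, exists N, forall M, (N <= M)%N -> u M n = l n.

Definition fps_lim (R : nmodType) (u : nat -> fps R) : fps R :=
  xget (@fps_zero R) [set l | fps_cvg u l]%classic.

(* prod_{n >= 1} F n *)
Definition fps_prod (R : comNzRingType) (F : nat -> fps R) : fps R :=
  fps_lim (fun N => \prod_(1 <= n < N.+1) F n).

Lemma fps_cvg_unique (R : Type) (u : nat -> fps R) (l l' : fps R) :
  fps_cvg u l -> fps_cvg u l' -> l = l'.
Proof.
move=> ul ul'; apply: fpsP => n.
have [N uN] := ul n; have [N' uN'] := ul' n.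
by rewrite -(uN (maxn N N')) ?leq_maxl // uN' ?leq_maxr.
Qed.

Lemma fps_limE (R : nmodType) (u : nat -> fps R) (l : fps R) :
  fps_cvg u l -> fps_lim u = l.
Proof.
move=> ul; apply: (fps_cvg_unique _ ul).
exact: (@xgetPex _ (@fps_zero R) [set l | fps_cvg u l]%classic (ex_intro _ l ul)).
Qed.

(* a = 1 + O(q^n) *)
Definition fps_one_mod (R : comNzRingType) (n : nat) (a : fps R) : Prop :=
  forall i, (i < n)%N -> a i = (i == 0%N)%:R.

Lemma fps_mul_one_mod (R : comNzRingType) n (a b : fps R) i :
  fps_one_mod n b -> (i < n)%N -> (a * b) i = a i.
Proof.
move=> b1 lt_in; rewrite fps_coefM big_ord_recr /= subnn b1; last first.
  exact: leq_trans lt_in.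
rewrite mulr1 big1 ?add0r // => j _.
have jP : (i - j == 0)%N = false.
  by apply/negbTE; rewrite subn_eq0 -ltnNge ltn_ord.
by rewrite b1 ?jP ?mulr0 //; apply: leq_ltn_trans (leq_subr _ _) lt_in.
Qed.

Lemma fps_one_modM (R : comNzRingType) n (a b : fps R) :
  fps_one_mod n a -> fps_one_mod n b -> fps_one_mod n (a * b).
Proof.
by move=> a1 b1 i lt_in; rewrite (fps_mul_one_mod _ b1) // a1.
Qed.

Lemma fps_one_modX (R : comNzRingType) n (a : fps R) r :
  fps_one_mod n a -> fps_one_mod n (a ^+ r).
Proof.
move=> a1; elim: r => [|r IHr] //.
by rewrite exprS; apply: fps_one_modM.
Qed.

Lemma fps_one_mod_unit (R : comUnitRingType) n (a : fps R) :
  (0 < n)%N -> fps_one_mod n a -> a \is a GRing.unit.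
Proof. by move=> n0 a1; rewrite fps_unitE a1 // unitr1. Qed.

Lemma fps_one_modV (R : comUnitRingType) n (a : fps R) :
  fps_one_mod n a -> fps_one_mod n a^-1.
Proof.
move=> a1 i lt_in; rewrite -(fps_mul_one_mod a^-1 a1 lt_in) mulVr //.
by apply: fps_one_mod_unit a1; apply: leq_ltn_trans lt_in.
Qed.

Lemma fps_prod_cvg (R : comNzRingType) (F : nat -> fps R) :
  (forall n, (0 < n)%N -> fps_one_mod n (F n)) ->
  fps_cvg (fun N => \prod_(1 <= n < N.+1) F n) (fps_prod F).
Proof.
move=> F1; pose u N := \prod_(1 <= n < N.+1) F n.
have ul : fps_cvg u (Fps (fun n => u n n)).
  move=> n; exists n => M; elim: M => [|M IHM].
    by rewrite leqn0 => /eqP ->.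
  rewrite leq_eqVlt => /predU1P[-> //|]; rewrite ltnS => le_nM.
  have uS : u M.+1 = u M * F M.+1 by rewrite /u big_nat_recr.
  by rewrite uS (fps_mul_one_mod _ (F1 M.+1 _)) //; apply: IHM.
by rewrite /fps_prod (fps_limE ul).
Qed.

(* n >= 1; for n = 0 the truncated 2 * n - 1 is meaningless, and fps_prod
   ignores this factor. *)
Definition schur9_factor (r n : nat) : fps int :=
  let q := fpsX int in
  ((1 + q ^+ (2 * n - 1)) ^+ r * (1 - q ^+ (9 * (2 * n - 1))) ^+ r) /
  ((1 + q ^+ (9 * (2 * n - 1))) ^+ r * (1 - q ^+ (2 * n - 1)) ^+ r).

(* Sbar_9^r(n), the number of 9-Schur overpartitions of n with r-tuples, as the
   coefficient of q^n in its generating product. *)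
Definition schur9_overpartitions (r n : nat) : int :=
  fps_prod (schur9_factor r) n.

Lemma fps_one_mod1DXn (R : comNzRingType) n k :
  (n <= k)%N -> fps_one_mod n (1 + fpsX R ^+ k).
Proof.
move=> le_nk i lt_in; rewrite fps_coefD fps_coefXn fps_coef1.
by rewrite (ltn_eqF (leq_trans lt_in le_nk)) addr0.
Qed.

Lemma fps_one_mod1BXn (R : comNzRingType) n k :
  (n <= k)%N -> fps_one_mod n (1 - fpsX R ^+ k).
Proof.
move=> le_nk i lt_in; rewrite fps_coefD fps_coefN fps_coefXn fps_coef1.
by rewrite (ltn_eqF (leq_trans lt_in le_nk)) subr0.
Qed.

Lemma schur9_denom_unit (r n : nat) : (0 < n)%N ->
  (1 + fpsX int ^+ (9 * (2 * n - 1))) ^+ r * (1 - fpsX int ^+ (2 * n - 1)) ^+ r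
    \is a GRing.unit.
Proof.
move=> n0; apply: (@fps_one_mod_unit _ 1) => //.
have n1 : (0 < 2 * n - 1)%N by case: n n0 => // n _; rewrite mulnS.
apply: fps_one_modM; apply: fps_one_modX.
  by apply: fps_one_mod1DXn; rewrite muln_gt0.
exact: fps_one_mod1BXn.
Qed.

Lemma schur9_cvg (r : nat) :
  fps_cvg (fun N => \prod_(1 <= n < N.+1) schur9_factor r n)
    (fps_prod (schur9_factor r)).
Proof.
apply: fps_prod_cvg => n n0.
have le1 : (n <= 2 * n - 1)%N by rewrite mul2n -addnn -addnBA // leq_addr.
have le9 : (n <= 9 * (2 * n - 1))%N by apply: leq_trans le1 _; rewrite leq_pmull.
apply: fps_one_modM; last apply: fps_one_modV; apply: fps_one_modM;
  apply: fps_one_modX; by [apply: fps_one_mod1DXn | apply: fps_one_mod1BXn].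
Qed.

(* The Legendre symbol (a / p). 'F_p is the field of order p only for prime p,
   so this is meaningful for odd primes only. *)
Definition legendre (a : int) (p : nat) : int :=
  if a%:~R == 0 :> 'F_p then 0
  else if [exists x : 'F_p, x ^+ 2 == a%:~R] then 1 else -1.

(* Main.v *)
(* Write G for the generating series with r = 1. Gauss' product for phi(-q) gives
   G = phi(q) phi(-q^9) / (phi(-q^2) phi(-q^18)); in particular G = 1 mod 2, so
   G^16 = 1 mod 32 and only G itself matters. The 2-dissection of phi, applied
   twice, exhibits sum_M G(4M+3) q^M as 4 times an explicit theta quotient; taking
   one more even part and then a 3-dissection modulo 32 gives
     G(24M+11) = 16 [q^M] f(q^2) psi(q^3)  (mod 32),
   where f = sum_k q^(k(3k+1)/2). A nonzero coefficient on the right yields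
   24M+11 = 2x^2 + 9y^2. Since -18 is not a square modulo p, the p-adic valuation
   of such a number is even, whereas p^(2 alpha + 1) exactly divides the argument
   of the theorem. *)
Require Import Defs.
From HB Require Import structures.
From mathcomp Require Import all_boot all_order all_algebra.
From mathcomp Require Import zify ring.

Set Implicit Arguments.
Unset Strict Implicit.
Unset Printing Implicit Defensive.

Import GRing.Theory Num.Theory.
Local Open Scope ring_scope.

(** * Dilations q -> q^k and sections along arithmetic progressions *)

Definition fps_dilate (R : nmodType) (k : nat) (a : fps R) : fps R :=
  Fps (fun n => if (k %| n)%N then a (n %/ k)%N else 0).

Definition fps_section (R : nmodType) (k r : nat) (a : fps R) : fps R :=
  Fps (fun n => a (k * n + r)%N).

Lemma fps_coef_dilate (R : nmodType) k (a : fps R) n :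
  fps_dilate k a n = if (k %| n)%N then a (n %/ k)%N else 0.
Proof. by []. Qed.

Lemma fps_coef_section (R : nmodType) k r (a : fps R) n :
  fps_section k r a n = a (k * n + r)%N.
Proof. by []. Qed.

Lemma sum_multiples (V : nmodType) k n r (F : nat -> V) : (r < k)%N ->
  \sum_(0 <= i < (k * n + r).+1) (if (k %| i)%N then F i else 0) =
  \sum_(0 <= j < n.+1) F (k * j)%N.
Proof.
move=> lt_rk.
have block m s : (s < k)%N ->
    \sum_(k * m <= i < (k * m + s).+1) (if (k %| i)%N then F i else 0) =
    F (k * m)%N.
  move=> lt_sk; rewrite big_ltn ?ltnS ?leq_addr // dvdn_mulr //.
  rewrite big_nat_cond big1 ?addr0 // => i; rewrite andbT => /andP[lo hi].
  case: ifP => // /dvdnP[c def_i]; move: lo hi; rewrite def_i (mulnC c).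
  rewrite ltnS => lo hi; have : (k * c < k * m.+1)%N by rewrite mulnS; lia.
  by rewrite ltn_mul2l ltnS => /andP[_ cm]; move: lo; rewrite ltn_mul2l; lia.
elim: n => [|n IHn] in r lt_rk *.
  by rewrite big_nat1 -(block 0%N r) // muln0.
rewrite (@big_cat_nat _ _ _ (k * n.+1)) //=; last by lia.
rewrite block // big_nat_recr //=; congr (_ + _).
have k_gt0 : (0 < k)%N by lia.
rewrite -(IHn k.-1) ?prednK //; congr (\sum_(0 <= i < _) _); lia.
Qed.

(** Only the indices i = kj contribute to the Cauchy product. This is the basic dissection tool: a
    factor in q^k passes through the extraction of a residue class. *)
Lemma fps_section_dilateM (R : comNzRingType) k r (a b : fps R) : (r < k)%N ->
  fps_section k r (fps_dilate k a * b) = a * fps_section k r b.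
Proof.
move=> lt_rk; have k_gt0 : (0 < k)%N by lia.
apply: fpsP => n; rewrite fps_coef_section !fps_coefM.
rewrite -(big_mkord xpredT (fun i => fps_dilate k a i * b (k * n + r - i)%N)).
under eq_bigr => i _ do
  rewrite fps_coef_dilate (fun_if (fun x => x * _)) mul0r.
rewrite (sum_multiples n (fun i => a (i %/ k)%N * b (k * n + r - i)%N)) //.
rewrite big_mkord; apply: eq_bigr => j _.
rewrite mulKn // fps_coef_section; congr (_ * b _).
by have := ltn_ord j; nia.
Qed.

Lemma fps_section_dilate (R : nmodType) k r (a : fps R) : (r < k)%N ->
  fps_section k r (fps_dilate k a) = if r == 0%N then a else Fps (fun=> 0).
Proof.
move=> lt_rk; have k_gt0 : (0 < k)%N by lia.
apply: fpsP => n /=; rewrite dvdn_addr ?dvdn_mulr //.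
case: eqP => [->|/eqP r_neq0]; first by rewrite dvdn0 addn0 mulKn.
by rewrite gtnNdvd ?lt0n.
Qed.

Lemma fps_dilate_is_additive (R : zmodType) k :
  zmod_morphism (@fps_dilate R k).
Proof.
by move=> a b; apply: fpsP => n /=; case: ifP => // _; rewrite subr0.
Qed.
HB.instance Definition _ (R : zmodType) k :=
  GRing.isZmodMorphism.Build (fps R) (fps R) (@fps_dilate R k)
    (@fps_dilate_is_additive R k).

Lemma fps_section_is_additive (R : zmodType) k r :
  zmod_morphism (@fps_section R k r).
Proof. by move=> a b; apply: fpsP. Qed.
HB.instance Definition _ (R : zmodType) k r :=
  GRing.isZmodMorphism.Build (fps R) (fps R) (@fps_section R k r)
    (@fps_section_is_additive R k r).

Lemma fps_dilate_is_multiplicative (R : comNzRingType) k :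
  monoid_morphism (@fps_dilate R k).
Proof.
split=> [|a b]; apply: fpsP => n.
  rewrite fps_coef_dilate !fps_coef1; case: ifP => [/dvdnP[c ->]|].
    by case: k => [|k]; rewrite ?muln0 ?divn0 // mulnK // muln_eq0 orbF.
  by case: n => //; rewrite dvdn0.
rewrite fps_coef_dilate; case: ifP => [kn|k'n].
  (* For k = 0 the dilation keeps only the constant term, since 0 divides only 0. *)
  case: (posnP k) => [k0|k_gt0].
    move: kn; rewrite k0 dvd0n => /eqP ->.
    by rewrite !fps_coefM0 !fps_coef_dilate.
  (* The coefficient at n = k(n/k) + 0 is read off the section of residue 0. *)
  rewrite -{2}(divnK kn) mulnC -[in RHS](addn0 (k * _)%N).
  by rewrite -fps_coef_section fps_section_dilateM // fps_section_dilate.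
rewrite fps_coefM big1 // => i _; rewrite !fps_coef_dilate.
case: ifP => [ki|]; last by rewrite mul0r.
case: ifP => [kni|]; last by rewrite mulr0.
by have := dvdn_add ki kni; rewrite subnKC ?k'n // -ltnS.
Qed.
HB.instance Definition _ (R : comNzRingType) k :=
  GRing.isMonoidMorphism.Build (fps R) (fps R) (@fps_dilate R k)
    (@fps_dilate_is_multiplicative R k).

Lemma fps_dilateX (R : comNzRingType) k : (0 < k)%N ->
  fps_dilate k (fpsX R) = fpsX R ^+ k.
Proof.
move=> k_gt0; apply: fpsP => n; rewrite fps_coef_dilate fps_coefXn /=.
case: ifP => [/dvdnP[c ->]|kn].
  by rewrite mulnK // -{2}(mul1n k) eqn_pmul2r.
by case: eqP kn => // ->; rewrite dvdnn.
Qed.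

Lemma fps_dilate_comp (R : nmodType) j k (a : fps R) : (0 < j)%N ->
  fps_dilate j (fps_dilate k a) = fps_dilate (j * k) a.
Proof.
move=> j_gt0; apply: fpsP => n; rewrite !fps_coef_dilate.
case: (boolP (j %| n)%N) => [/dvdnP[c ->]|jn].
  by rewrite mulnK // (mulnC j) dvdn_pmul2r // divnMr.
by case: ifP => // /(dvdn_trans (dvdn_mulr _ (dvdnn j))) /negPn; rewrite jn.
Qed.

Lemma fps_dilate_inj (R : nmodType) k : (0 < k)%N ->
  injective (@fps_dilate R k).
Proof.
move=> k_gt0 a b /(congr1 (fps_section k 0)).
by rewrite !fps_section_dilate.
Qed.

Lemma fps_section_comp (R : nmodType) j r k s (a : fps R) :
  fps_section j r (fps_section k s a) = fps_section (k * j) (k * r + s) a.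
Proof.
by apply: fpsP => n /=; congr (a _); rewrite mulnDr mulnA addnA.
Qed.

Lemma fps_sectionXM (R : comNzRingType) k r j (a : fps R) : (r < k)%N ->
  fps_section k r (fpsX R ^+ j * fps_dilate k a) =
  if (j == r %[mod k]) then
    fpsX R ^+ (j %/ k) * a else 0.
Proof.
move=> lt_rk; rewrite mulrC fps_section_dilateM //.
have -> : fps_section k r (fpsX R ^+ j) =
    if (j == r %[mod k]) then fpsX R ^+ (j %/ k) else 0.
  apply: fpsP => n; rewrite fps_coef_section fps_coefXn (modn_small lt_rk).
  case: (altP (j %% k =P r)%N) => [def_r|jr].
    rewrite fps_coefXn [in LHS](divn_eq j k) def_r eqn_add2r mulnC.
    by rewrite eqn_pmul2r //; lia.
  rewrite fps_coef0; case: eqP => // def_j; move: jr.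
  by rewrite -def_j mulnC modnMDl modn_small ?eqxx.
by case: ifP => _; rewrite ?mulr0 // mulrC.
Qed.

(** * Theta series and their dissections *)

Definition is_square (n : nat) : bool := [exists x : 'I_n.+1, (x * x == n)%N].

Lemma is_squareP n : reflect (exists x, n = x * x)%N (is_square n).
Proof.
apply: (iffP existsP) => [[x /eqP <-]|[x ->]]; first by exists x.
have lt_x : (x < (x * x).+1)%N by nia.
by exists (Ordinal lt_x).
Qed.

Lemma is_squareMsqr k n : (0 < k)%N -> is_square (k * k * n) = is_square n.
Proof.
move=> k_gt0; apply/is_squareP/is_squareP => [[x def_x]|[x ->]]; last first.
  by exists (k * x)%N; lia.
have /dvdnP[y def_y] : (k %| x)%N.
  by rewrite -(dvdn_pexp2r _ _ (isT : 0 < 2)%N) -!mulnn -def_x dvdn_mulr.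
exists y; have : (k * k * n == k * k * (y * y))%N.
  by apply/eqP; rewrite def_x def_y; lia.
by rewrite eqn_pmul2l ?muln_gt0 ?k_gt0 // => /eqP.
Qed.

Lemma is_square_modF d n : (0 < d)%N ->
  all (fun x => x * x != n %[mod d])%N (iota 0 d) -> is_square n = false.
Proof.
move=> d_gt0 /allP nsq; apply/is_squareP => -[x def_n].
have := nsq (x %% d)%N; rewrite mem_iota ltn_mod d_gt0 def_n modnMm.
by rewrite eqxx => /(_ isT).
Qed.

(* Each exponent occurs as a completed square, e.g. 8 k(k+1)/2 + 1 = (2k+1)^2:
   phi = sum_{k in Z} q^(k^2), psi = sum_{k >= 0} q^(k(k+1)/2),
   penta = sum_{k in Z} q^(k(3k+1)/2) and omega = sum_{k in Z} q^(k(3k+2)). *)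
Definition theta_phi : fps int :=
  Fps (fun n => if n == 0%N then 1 else if is_square n then 2 else 0).
Definition theta_psi : fps int := Fps (fun n => (is_square (8 * n + 1))%:R).
Definition theta_penta : fps int := Fps (fun n => (is_square (24 * n + 1))%:R).
Definition theta_omega : fps int := Fps (fun n => (is_square (3 * n + 1))%:R).

Lemma fps_coef_nat_mul (R : comNzRingType) k (a : fps R) n :
  (k%:R * a) n = k%:R * a n.
Proof.
rewrite !mulr_natl; by elim: k => // k IHk; rewrite !mulrS fps_coefD IHk.
Qed.

Lemma fps_coefXnM (R : comNzRingType) k (a : fps R) n :
  (fpsX R ^+ k * a) n = if (k <= n)%N then a (n - k)%N else 0.
Proof.
elim: k n => [|k IHk] n; first by rewrite expr0 mul1r subn0.
by rewrite exprS -mulrA fps_coefXM; case: n => // n.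
Qed.

Lemma fps_coef_natXnM (R : comNzRingType) c k (a : fps R) n :
  (c%:R * fpsX R ^+ k * a) n = if (k <= n)%N then c%:R * a (n - k)%N else 0.
Proof.
by rewrite -mulrA fps_coef_nat_mul fps_coefXnM; case: ifP; rewrite ?mulr0.
Qed.

Local Notation V := fps_dilate.
Local Notation X := (fpsX int).
Local Notation phi := theta_phi.
Local Notation psi := theta_psi.
Local Notation penta := theta_penta.
Local Notation omega := theta_omega.

Lemma mulr_indicator c (b : bool) : (if b then c%:R else 0) = c%:R * b%:R :> int.
Proof. by case: b; rewrite ?mulr1 ?mulr0. Qed.

Lemma is_square_4M1 k : is_square (4 * k + 1) -> exists j, (k = 2 * j)%N.
Proof.
move=> /is_squareP[x def_x].
have x_odd : odd x by move: (congr1 odd def_x); rewrite oddD !oddM /= andbb.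
have def_k : k = (x./2 * x./2.+1)%N.
  by have := odd_double_half x; rewrite x_odd; nia.
have k_even : ~~ odd k by rewrite def_k oddM /=; case: (odd _).
by exists k./2; have := odd_double_half k; rewrite (negPf k_even); lia.
Qed.

(** Even squares are 4j^2; odd squares are 8t + 1 with t triangular, each reached from two signs. *)
Lemma phi_2dissection : phi = V 4 phi + 2%:R * X ^+ 1 * V 8 psi.
Proof.
apply: fpsP => n; rewrite fps_coefD fps_coef_natXnM !fps_coef_dilate.
rewrite (divn_eq n 4); have := ltn_pmod n (isT : 0 < 4)%N.
move: (n %/ 4)%N (n %% 4)%N => k; case=> [|[|[|[|//]]]] _.
- have sq4 : is_square (k * 4) = is_square k.
    by rewrite -(@is_squareMsqr 2 k) //; congr is_square; lia.
  rewrite [X in _ + X](_ : _ = 0) ?addr0; last first.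
    by case: ifP => // k_gt0; rewrite ifN ?mulr0 //; lia.
  by rewrite addn0 dvdn_mull // mulnK //= sq4 muln_eq0 orbF.
- rewrite ifN; last by lia.
  rewrite ifT; last by lia.
  rewrite add0r addnK (mulnC k) /= ifN; last by lia.
  case: (boolP (8 %| 4 * k)%N) => [/dvdnP[j def_j]|].
    have -> : (k = 2 * j)%N by lia.
    by rewrite mulnA mulKn //= -mulr_indicator.
  rewrite mulr0; case: ifP => // /is_square_4M1[j ->].
  by rewrite mulnA dvdn_mulr.
- rewrite /= (@is_square_modF 4) //=; last by rewrite !modnMDl.
  rewrite addn_eq0 andbF ifN ?add0r; last by lia.
  by rewrite ifT ?ifN ?mulr0 //; lia.
- rewrite /= (@is_square_modF 4) //=; last by rewrite !modnMDl.
  rewrite addn_eq0 andbF ifN ?add0r; last by lia.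
  by rewrite ifT ?ifN ?mulr0 //; lia.
Qed.

Lemma is_square_mul3 k : is_square (3 * k) -> exists j, (k = 3 * j)%N.
Proof.
move=> /is_squareP[x def_x].
have /dvdnP[y def_y] : (3 %| x)%N.
  by rewrite -[(3 %| x)%N]orbb -Euclid_dvdM // -def_x dvdn_mulr.
by exists (y * y)%N; nia.
Qed.

(** For n = 3k, 8n + 1 = 24k + 1. For n = 3k + 1, 8n + 1 = 3(8k + 3) is a square only if k = 3j, and
    then equals 9(8j + 1). For n = 3k + 2 it is 2 mod 3. *)
Lemma psi_3dissection : psi = V 3 penta + X ^+ 1 * V 9 psi.
Proof.
apply: fpsP => n; rewrite fps_coefD fps_coefXnM !fps_coef_dilate.
rewrite (divn_eq n 3); have := ltn_pmod n (isT : 0 < 3)%N.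
move: (n %/ 3)%N (n %% 3)%N => k; case=> [|[|[|//]]] _.
- have -> : psi (k * 3 + 0)%N = penta k.
    by rewrite /= addn0 mulnCA mulnC -mulnA.
  rewrite [X in _ + X](_ : _ = 0) ?addr0; last first.
    by case: ifP => // k_gt0; rewrite ifN //; lia.
  by rewrite addn0 dvdn_mull // mulnK.
- rewrite ifN; last by lia.
  rewrite ifT; last by lia.
  rewrite add0r addnK (mulnC k) /=.
  have -> : (8 * (3 * k + 1) + 1 = 3 * (8 * k + 3))%N by lia.
  case: ifP => [/dvdnP[j def_j]|].
    have -> : (k = 3 * j)%N by lia.
    rewrite (mulnA 3 3) mulKn //; congr ((nat_of_bool _)%:R).
    by rewrite -[RHS](@is_squareMsqr 3) //; congr is_square; lia.
  move=> k9; case: (boolP (is_square _)) => // /is_square_mul3[j def_j].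
  by lia.
- rewrite /= (@is_square_modF 3) //=; last first.
    have -> : (8 * (k * 3 + 2) + 1 = (8 * k + 5) * 3 + 2)%N by lia.
    by rewrite !modnMDl.
  rewrite ifN ?add0r; last by lia.
  by rewrite ifT ?ifN //; lia.
Qed.

(** A square divisible by 3 is divisible by 9; the others are 1 mod 3, with two roots each. *)
Lemma phi_3dissection : phi = V 9 phi + 2%:R * X ^+ 1 * V 3 omega.
Proof.
apply: fpsP => n; rewrite fps_coefD fps_coef_natXnM !fps_coef_dilate.
rewrite (divn_eq n 3); have := ltn_pmod n (isT : 0 < 3)%N.
move: (n %/ 3)%N (n %% 3)%N => k; case=> [|[|[|//]]] _.
- rewrite [X in _ + X](_ : _ = 0) ?addr0; last first.
    by case: ifP => // k_gt0; rewrite ifN ?mulr0 //; lia.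
  rewrite addn0 (mulnC k); case: ifP => [/dvdnP[j def_j]|k9].
    have -> : (k = 3 * j)%N by lia.
    rewrite (mulnA 3 3) mulKn //= muln_eq0 /=.
    by rewrite -[is_square j](@is_squareMsqr 3).
  rewrite /= muln_eq0 /=; case: eqP k9 => [-> //|_ k9].
  by case: ifP => // /is_square_mul3[j def_j]; lia.
- rewrite ifN; last by lia.
  rewrite ifT; last by lia.
  by rewrite add0r addnK dvdn_mull // mulnK //= addn_eq0 andbF mulnC mulr_indicator.
- rewrite /= (@is_square_modF 3) //=; last by rewrite !modnMDl.
  rewrite addn_eq0 andbF ifN ?add0r; last by lia.
  by rewrite ifT ?ifN ?mulr0 //; lia.
Qed.

(** * Gauss' product for phi(-q) *)

(* The substitution q -> c q. *)
Definition fps_rescale (R : pzSemiRingType) (c : R) (a : fps R) : fps R :=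
  Fps (fun n => c ^+ n * a n).

Lemma fps_rescale_is_additive (R : comNzRingType) (c : R) :
  zmod_morphism (fps_rescale c).
Proof. by move=> a b; apply: fpsP => n /=; rewrite mulrBr. Qed.
HB.instance Definition _ (R : comNzRingType) (c : R) :=
  GRing.isZmodMorphism.Build (fps R) (fps R) (fps_rescale c)
    (fps_rescale_is_additive c).

Lemma fps_rescale_is_multiplicative (R : comNzRingType) (c : R) :
  monoid_morphism (fps_rescale c).
Proof.
split=> [|a b]; apply: fpsP => n /=.
  by case: n => [|n]; rewrite ?mulr1 ?mulr0.
rewrite mulr_sumr; apply: eq_bigr => i _.
by rewrite mulrACA -exprD subnKC // -ltnS.
Qed.
HB.instance Definition _ (R : comNzRingType) (c : R) :=
  GRing.isMonoidMorphism.Build (fps R) (fps R) (fps_rescale c)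
    (fps_rescale_is_multiplicative c).

Lemma fps_rescaleX (R : comNzRingType) (c : R) :
  fps_rescale c (fpsX R) = fpsC c * fpsX R.
Proof.
apply: fpsP => n; rewrite fps_coefCM /=.
by case: n => [|[|n]]; rewrite ?mulr0 ?mulr1 ?expr1.
Qed.

Lemma fps_cvgM (R : comNzRingType) (u v : nat -> fps R) (a b : fps R) :
  fps_cvg u a -> fps_cvg v b -> fps_cvg (fun N => u N * v N) (a * b).
Proof.
move=> ua vb n.
(* Coefficient n of a product involves only indices up to n, so one stabilisation bound must serve
   all of them. *)
have unif (w : nat -> fps R) l : fps_cvg w l ->
    exists N, forall M i, (N <= M)%N -> (i <= n)%N -> w M i = l i.
  move=> wl; elim: n => [|n [N IHn]].
    have [N wN] := wl 0%N; exists N => M i leNM.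
    by rewrite leqn0 => /eqP ->; apply: wN.
  have [N' wN'] := wl n.+1; exists (maxn N N') => M i.
  rewrite geq_max => /andP[leN leN']; rewrite leq_eqVlt => /predU1P[->|].
    exact: wN'.
  exact: IHn.
have [N uN] := unif _ _ ua; have [N' vN'] := unif _ _ vb.
exists (maxn N N') => M; rewrite geq_max => /andP[leN leN'].
rewrite !fps_coefM; apply: eq_bigr => i _.
by rewrite uN ?vN' ?leq_subr // -ltnS.
Qed.

Lemma fps_cvgX (R : comNzRingType) (u : nat -> fps R) (a : fps R) r :
  fps_cvg u a -> fps_cvg (fun N => u N ^+ r) (a ^+ r).
Proof.
move=> ua; elim: r => [|r IHr]; first by move=> n; exists 0%N.
move=> n; have [N uN] := fps_cvgM ua IHr n.
by exists N => M /uN; rewrite !exprS.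
Qed.

Lemma fps_cvg_dilate (R : nmodType) k (u : nat -> fps R) (a : fps R) :
  fps_cvg u a -> fps_cvg (fun N => V k (u N)) (V k a).
Proof.
move=> ua n; have [N uN] := ua (n %/ k)%N.
by exists N => M leNM; rewrite !fps_coef_dilate uN.
Qed.

Lemma fps_cvg_rescale (R : comNzRingType) (c : R) (u : nat -> fps R) (a : fps R) :
  fps_cvg u a -> fps_cvg (fun N => fps_rescale c (u N)) (fps_rescale c a).
Proof.
by move=> ua n; have [N uN] := ua n; exists N => M leNM /=; rewrite uN.
Qed.

Lemma fps_cvg_double (R : Type) (u : nat -> fps R) (a : fps R) :
  fps_cvg u a -> fps_cvg (fun N => u (2 * N)%N) a.
Proof. by move=> ua n; have [N uN] := ua n; exists N => M ?; apply: uN; lia. Qed.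

Lemma fps_cvg_congr (R : Type) (u v : nat -> fps R) (a : fps R) :
  (forall N, u N = v N) -> fps_cvg u a -> fps_cvg v a.
Proof. by move=> uv ua n; have [N uN] := ua n; exists N => M /uN; rewrite uv. Qed.

Lemma fps_1DXn_unit k : (0 < k)%N -> 1 + X ^+ k \is a GRing.unit.
Proof. by move=> k0; apply: (fps_one_mod_unit k0); apply: fps_one_mod1DXn. Qed.

Lemma fps_1BXn_unit k : (0 < k)%N -> 1 - X ^+ k \is a GRing.unit.
Proof. by move=> k0; apply: (fps_one_mod_unit k0); apply: fps_one_mod1BXn. Qed.

Definition shanks_factor k : fps int := (1 - X ^+ k) / (1 + X ^+ k).
Definition shanks_prod m n : fps int := \prod_(m <= k < n) shanks_factor k.
(** The error terms of the finite identity: the s-th is divisible by q^(s(n+1)), hence vanishes in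
    the limit. *)
Definition shanks_term n s : fps int :=
  2%:R * (-1) ^+ s * X ^+ (s * n.+1) * (1 + X ^+ s)^-1 * shanks_prod s.+1 n.+1.

Lemma shanks_termB n s : (0 < s <= n)%N ->
  shanks_term n.+1 s - shanks_term n s =
  - (2%:R * (1 + X ^+ n.+1)^-1) *
    ((-1) ^+ s * X ^+ (s * n.+1) * shanks_prod s n.+1 -
     (-1) ^+ s.+1 * X ^+ (s.+1 * n.+1) * shanks_prod s.+1 n.+1).
Proof.
case/andP=> s_gt0 le_sn; rewrite /shanks_term.
rewrite /shanks_prod [\prod_(s.+1 <= k < n.+2) _]big_nat_recr //=.
rewrite [\prod_(s <= k < n.+1) _]big_ltn // -/(shanks_prod _ _).
rewrite /shanks_factor (mulnS s n.+1) (mulSn s) !exprD [(-1) ^+ s.+1]exprS.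
have := mulrV (fps_1DXn_unit s_gt0).
have := mulrV (fps_1DXn_unit (ltn0Sn n)).
(* With the inverses as variables, what remains is a polynomial identity modulo (1 + x)i = 1 and (1
   + y)j = 1. *)
move: (_ ^-1) (_ ^-1) (X ^+ (s * n.+1)) (shanks_prod _ _) => i j A g.
move: (X ^+ s) (X ^+ n.+1) ((-1) ^+ s) => x y e hj hi.
have hi' : y = y * ((1 + x) * i) by rewrite hi mulr1.
transitivity (2%:R * e * A * i * g * (x * (1 - y) * j - (1 + y) * j)).
  by rewrite hj; ring.
transitivity (- (2%:R * j) * e * A * g * ((1 - x) * i + y * ((1 + x) * i))).
  by ring.
by rewrite -hi'; ring.
Qed.

(* Shanks' finite form of Gauss' product for phi(-q): passing from n to n + 1
   changes the s-th term by a telescoping quantity. *)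
Lemma shanks_identity n :
  1 + 2%:R * \sum_(1 <= s < n.+1) (-1) ^+ s * X ^+ (s * s) =
  shanks_prod 1 n.+1 + \sum_(1 <= s < n.+1) shanks_term n s.
Proof.
elim: n => [|n IHn].
  by rewrite /shanks_prod !big_geq // mulr0 addr0.
rewrite big_nat_recr // mulrDr addrA {}IHn [in RHS]big_nat_recr //=.
(* The increments of the error terms are multiples of v s - v (s+1); only the boundary values v 1
   and v (n+1) remain. *)
pose v s := (-1) ^+ s * X ^+ (s * n.+1) * shanks_prod s n.+1.
have -> : \sum_(1 <= s < n.+1) shanks_term n.+1 s =
    \sum_(1 <= s < n.+1) shanks_term n s +
    - (2%:R * (1 + X ^+ n.+1)^-1) * (v 1%N - v n.+1).
  rewrite -[v 1%N - _]opprB -telescope_sumr // mulrN -mulNr mulr_sumr -big_split /=.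
  rewrite big_nat_cond [RHS]big_nat_cond; apply: eq_bigr => s.
  rewrite andbT ltnS => s_bd; rewrite -[LHS](subrK (shanks_term n s)).
  by rewrite shanks_termB // addrC /v; congr (_ + _); ring.
rewrite {}/v /shanks_term /shanks_prod [\prod_(1 <= k < n.+2) _]big_nat_recr //=.
rewrite !(big_geq (leqnn _)) mul1n (mulnS n.+1 n.+1) exprD /shanks_factor.
set F := \prod_(_ <= _ < _) _; set S := \sum_(_ <= _ < _) _.
have := mulrV (fps_1DXn_unit (ltn0Sn n)).
move: (X ^+ (n.+1 * n.+1)) (X ^+ n.+1) ((-1) ^+ n.+1) (_ ^-1) => A y e j hj.
transitivity (F * ((1 + y) * j) + S + 2%:R * (e * A) * ((1 + y) * j)).
  by rewrite hj; ring.
by ring.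
Qed.

Lemma fps_coef_phim_partial n N : (n <= N)%N ->
  (1 + 2%:R * \sum_(1 <= s < N.+1) (-1) ^+ s * X ^+ (s * s)) n =
  fps_rescale (-1) phi n.
Proof.
move=> le_nN; rewrite fps_coefD fps_coef1 fps_coef_nat_mul fps_coef_sum.
have coef s : ((-1) ^+ s * X ^+ (s * s)) n =
    if (s * s == n)%N then (-1) ^+ s else 0.
  have -> : (-1) ^+ s = fpsC ((-1) ^+ s) :> fps int.
    apply: fpsP => i; rewrite -[in LHS]signr_odd -[in RHS]signr_odd.
    by case: (odd s); rewrite ?expr0 ?expr1 //=; case: i.
  rewrite fps_coefCM fps_coefXn eq_sym.
  by case: ifP; rewrite ?mulr1 ?mulr0.
under eq_bigr do rewrite coef.
case: (posnP n) => [->|n_gt0].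
  rewrite /= expr0 !mul1r big_nat_cond big1 ?mulr0 ?addr0 // => s.
  by rewrite andbT muln_eq0; case: s.
rewrite /= gtn_eqF // add0r; case: ifP => [/is_squareP[x def_n]|nsq].
  have x_in : x \in index_iota 1 N.+1 by rewrite mem_index_iota; nia.
  rewrite (bigD1_seq x) ?iota_uniq //= def_n eqxx big1 ?addr0.
    (* The signs agree because x and x^2 have the same parity. *)
    by rewrite mulrC -[in RHS]signr_odd oddM andbb signr_odd.
  move=> s /negPf sx; rewrite ifN //; apply: contraFN sx; nia.
rewrite mulr0 big1 ?mulr0 // => s _; rewrite ifN //.
by apply: contraFN nsq => /eqP <-; apply/is_squareP; exists s.
Qed.

(* Gauss: phi(-q) = prod_{k >= 1} (1 - q^k) / (1 + q^k). *)
Lemma shanks_prod_cvg :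
  fps_cvg (fun n => shanks_prod 1 n.+1) (fps_rescale (-1) phi).
Proof.
move=> n; exists n => N le_nN; rewrite -(fps_coef_phim_partial le_nN).
rewrite shanks_identity fps_coefD fps_coef_sum big_nat_cond.
rewrite big1 ?addr0 // => s; rewrite andbT => /andP[s_gt0 _].
rewrite /shanks_term [_ * X ^+ _]mulrC -!mulrA fps_coefXnM ifN //.
by rewrite -ltnNge; nia.
Qed.

Lemma fps_dilateXn k n : (0 < k)%N -> V k (X ^+ n) = X ^+ (k * n).
Proof. by move=> k0; rewrite rmorphXn /= fps_dilateX // exprM. Qed.

(** The product over n >= 1 is phi(-q^2) / phi(-q); the generating series is this product divided by
    its dilation by 9. *)
Definition odd_ratio (n : nat) : fps int :=
  (1 + X ^+ (2 * n - 1)) / (1 - X ^+ (2 * n - 1)).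

(** The factors of odd index cancel against the ratios, leaving the even indices k = 2j. *)
Lemma shanks_prod_odd_ratio N :
  shanks_prod 1 (2 * N).+1 * \prod_(1 <= n < N.+1) odd_ratio n =
  V 2 (shanks_prod 1 N.+1).
Proof.
elim: N => [|N IHN].
  by rewrite /shanks_prod !big_geq // mulr1 rmorph1.
rewrite /shanks_prod !mulnS !add2n big_nat_recr //= (big_nat_recr (2 * N).+1) //=.
rewrite (big_nat_recr N.+1) //= (big_nat_recr N.+1) //= rmorphM /= -/(shanks_prod _ _).
rewrite -IHN /shanks_factor /odd_ratio.
have -> : (2 * N.+1 - 1 = (2 * N).+1)%N by lia.
rewrite rmorphM rmorphV ?fps_1DXn_unit //= rmorphB rmorphD rmorph1 /=.
rewrite fps_dilateXn //.
have -> : (2 * N.+1 = (2 * N).+2)%N by lia.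
have := mulrV (fps_1DXn_unit (ltn0Sn (2 * N))).
have := mulrV (fps_1BXn_unit (ltn0Sn (2 * N))).
rewrite -/(shanks_prod _ _).
move: (X ^+ _.+1) (_^-1) (_^-1) (_^-1) => x a b c ha hb.
transitivity (shanks_prod 1 (2 * N).+1 * \prod_(1 <= n < N.+1) odd_ratio n *
    ((1 - X ^+ (2 * N).+2) * a) * (((1 + x) * b) * ((1 - x) * c))).
  by rewrite /odd_ratio; ring.
by rewrite ha hb !mulr1.
Qed.

(** The exponent is odd, so q -> -q exchanges numerator and denominator. *)
Lemma odd_ratio_rescale n : (0 < n)%N ->
  odd_ratio n * fps_rescale (-1) (odd_ratio n) = 1.
Proof.
move=> n_gt0; have odd_gt0 : (0 < 2 * n - 1)%N by lia.
have rX : fps_rescale (-1) (X ^+ (2 * n - 1)) = - X ^+ (2 * n - 1).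
  rewrite rmorphXn /= fps_rescaleX.
  have -> : fpsC (-1) = -1 :> fps int by apply: fpsP => -[].
  rewrite mulN1r exprNn -signr_odd oddB; last by lia.
  by rewrite oddM /= mulN1r.
rewrite /odd_ratio rmorphM rmorphV ?fps_1BXn_unit //=.
rewrite rmorphB rmorphD rmorph1 /= rX opprK mulrACA.
by rewrite -invrM ?fps_1DXn_unit ?fps_1BXn_unit // mulrV // unitrM
  fps_1DXn_unit ?fps_1BXn_unit.
Qed.

(** Multiply [shanks_prod_odd_ratio] by its image under q -> -q: the odd ratios cancel, the right
    side is invariant, and N tends to infinity. *)
Lemma phi_mul_phim :
  phi * fps_rescale (-1) phi = V 2 (fps_rescale (-1) phi) ^+ 2.
Proof.
have F_cvg := fps_cvg_double shanks_prod_cvg.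
have rrK : fps_rescale (-1) (fps_rescale (-1) phi) = phi.
  by apply: fpsP => n /=; rewrite mulrA -exprMn mulrNN mulr1 expr1n mul1r.
have := fps_cvgM (fps_cvg_rescale (-1) F_cvg) F_cvg; rewrite rrK => l1.
apply: fps_cvg_unique l1 _.
apply: fps_cvg_congr (fps_cvgX 2 (fps_cvg_dilate 2 shanks_prod_cvg)) => N /=.
have resK : V 2 (shanks_prod 1 N.+1) = fps_rescale (-1) (V 2 (shanks_prod 1 N.+1)).
  apply: fpsP => n /=; case: ifP => [|_]; last by rewrite mulr0.
  by rewrite -signr_odd dvdn2 => /negPf ->; rewrite mul1r.
rewrite expr2 {1}resK -shanks_prod_odd_ratio rmorphM /= mulrACA.
rewrite [X in _ * X](_ : _ = 1) ?mulr1 //.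
rewrite rmorph_prod /= -big_split /= big_nat_cond big1 // => n.
by rewrite andbT mulrC => /andP[n_gt0 _]; rewrite odd_ratio_rescale.
Qed.

(** * The generating series as a theta quotient *)

Definition schur9_series : fps int := fps_prod (schur9_factor 1).

Lemma schur9_overpartitionsE r n :
  schur9_overpartitions r n = (schur9_series ^+ r) n.
Proof.
rewrite /schur9_overpartitions; congr (fps_coef _ n).
apply: fps_cvg_unique (schur9_cvg r) _.
apply: fps_cvg_congr (fps_cvgX r (schur9_cvg 1)) => N /=.
rewrite -prodrXl big_nat_cond [RHS]big_nat_cond; apply: eq_bigr => k.
rewrite andbT => /andP[k_gt0 _]; have odd_gt0 : (0 < 2 * k - 1)%N by lia.
by rewrite /schur9_factor !expr1 exprMn exprVn !exprMn.
Qed.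

(** Denominators are cleared. Partial products up to 2N stand beside those up to N, so that
    [shanks_prod_odd_ratio] applies before passing to the limit. *)
Lemma schur9_series_phim (n := fps_rescale (-1) phi) :
  schur9_series * n * V 18 n = V 2 n * V 9 n.
Proof.
have F_cvg := shanks_prod_cvg; have F2_cvg := fps_cvg_double F_cvg.
apply: fps_cvg_unique (fps_cvgM (fps_cvgM (schur9_cvg 1) F2_cvg)
  (fps_cvg_dilate 18 F_cvg)) _.
apply: fps_cvg_congr (fps_cvgM (fps_cvg_dilate 2 F_cvg)
  (fps_cvg_dilate 9 F2_cvg)) => N /=.
rewrite -(@fps_dilate_comp _ 9 2) // -!shanks_prod_odd_ratio rmorphM /=.
have oddE : \prod_(1 <= n < N.+1) schur9_factor 1 n *
    V 9 (\prod_(1 <= n < N.+1) odd_ratio n) = \prod_(1 <= n < N.+1) odd_ratio n.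
  rewrite rmorph_prod -big_split /= big_nat_cond [RHS]big_nat_cond.
  apply: eq_bigr => k; rewrite andbT => /andP[k_gt0 _].
  have odd_gt0 : (0 < 2 * k - 1)%N by lia.
  rewrite /schur9_factor /odd_ratio !expr1 rmorphM rmorphV ?fps_1BXn_unit //=.
  rewrite rmorphB rmorphD rmorph1 /= fps_dilateXn //.
  rewrite invrM ?fps_1DXn_unit ?fps_1BXn_unit ?muln_gt0 //.
  have := mulrV (fps_1DXn_unit (_ : 0 < 9 * (2 * k - 1))%N).
  rewrite muln_gt0 => /(_ odd_gt0).
  have := mulrV (fps_1BXn_unit (_ : 0 < 9 * (2 * k - 1))%N).
  rewrite muln_gt0 => /(_ odd_gt0).
  move: (X ^+ _) (X ^+ _) => x y.
  move: (_^-1) (_^-1) (_^-1) => a b c hb hc.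
  transitivity ((1 + x) * a * (((1 + y) * b) * ((1 - y) * c))); first by ring.
  by rewrite hb hc !mulr1.
by rewrite -{1}oddE; ring.
Qed.

(** * Quadratic theta identities *)

Local Notation phim := (fps_rescale (-1) theta_phi).
Local Notation U := fps_section.

Lemma fps_dilateX_int k : (0 < k)%N -> V k X = X ^+ k.
Proof. exact: fps_dilateX. Qed.

(** Dilations are pushed down to the theta series and their indices evaluated to numerals, so that
    equal atoms coincide syntactically for [ring]. *)
Ltac dilate_ring :=
  rewrite ?(rmorphM, rmorphD, rmorphN, rmorphXn, rmorph_nat, rmorph1) /=
    ?fps_dilate_comp // ?fps_dilateX_int //;
  repeat match goal with |- context [muln ?a ?b] =>
    let c := eval compute in (muln a b) in change (muln a b) with c end;
  ring.

Lemma fps_section2_0 (a b : fps int) : U 2 0 (V 2 a + X * V 2 b) = a.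
Proof.
rewrite raddfD /= fps_section_dilate //=.
by rewrite -(expr1 X) fps_sectionXM //= addr0.
Qed.

Lemma fps_section2_1 (a b : fps int) : U 2 1 (V 2 a + X * V 2 b) = b.
Proof.
rewrite raddfD /= fps_section_dilate //=.
by rewrite -[X in X * _]expr1 fps_sectionXM //= mul1r add0r.
Qed.

Lemma fps_section3_1 (a b c : fps int) :
  U 3 1 (V 3 a + X * V 3 b + X ^+ 2 * V 3 c) = b.
Proof.
rewrite !raddfD /= fps_section_dilate //=.
by rewrite -[X in X * _]expr1 !fps_sectionXM //= mul1r add0r addr0.
Qed.

Lemma fps_dissection2 (a : fps int) : a = V 2 (U 2 0 a) + X * V 2 (U 2 1 a).
Proof.
apply: fpsP => n; rewrite fps_coefD -[X in X * _]expr1 fps_coefXnM.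
rewrite !fps_coef_dilate !fps_coef_section.
rewrite (divn_eq n 2); have := ltn_pmod n (isT : 0 < 2)%N.
move: (n %/ 2)%N (n %% 2)%N => k; case=> [|[|//]] _.
  rewrite [X in _ + X](_ : _ = 0) ?addr0; last first.
    by case: ifP => // k_gt0; rewrite ifN //; lia.
  by rewrite addn0 dvdn_mull // mulnK // mulnC addn0.
rewrite ifN ?add0r; last by lia.
by rewrite addnK dvdn_mull // mulnK // mulnC ifT //; lia.
Qed.

Lemma fps_mulf_nat_inj k (a b : fps int) : (0 < k)%N ->
  k%:R * a = k%:R * b -> a = b.
Proof.
move=> k_gt0 ab; apply: fpsP => n; have := congr1 (fun c : fps int => c n) ab.
rewrite !fps_coef_nat_mul; apply: mulfI.
by rewrite pnatr_eq0 -lt0n.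
Qed.

Lemma fps_rescaleN1_dilate k (a : fps int) :
  fps_rescale (-1) (V (2 * k) a) = V (2 * k) a.
Proof.
apply: fpsP => n /=; case: ifP => [kn|_]; last by rewrite mulr0.
have : ~~ odd n by rewrite -dvdn2; apply: dvdn_trans kn; apply: dvdn_mulr.
by rewrite -signr_odd => /negPf ->; rewrite mul1r.
Qed.

Lemma fps_rescaleN1X : fps_rescale (-1) X = - X.
Proof.
by rewrite fps_rescaleX -[RHS]mulN1r; congr (_ * _); apply: fpsP => -[].
Qed.

Lemma phim_2dissection : phim = V 4 phi - 2%:R * X * V 8 psi.
Proof.
rewrite {1}phi_2dissection expr1 rmorphD !rmorphM rmorph_nat /= fps_rescaleN1X.
rewrite (@fps_rescaleN1_dilate 2) (@fps_rescaleN1_dilate 4); ring.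
Qed.

(** The product phi(q) phi(-q) = phi(-q^2)^2 is a difference of squares by the 2-dissection of phi;
    undoing q -> q^2 gives phi(-q)^2, and q -> -q gives the claim. *)
Lemma phi_sqr_2dissection :
  phi ^+ 2 = V 2 (phi ^+ 2) + X * V 2 (4%:R * V 2 (psi ^+ 2)).
Proof.
have phim_sqr : phim ^+ 2 = V 2 (phi ^+ 2) - X * V 2 (4%:R * V 2 (psi ^+ 2)).
  apply: (@fps_dilate_inj _ 2) => //; rewrite rmorphXn /= -phi_mul_phim.
  by rewrite phim_2dissection {1}phi_2dissection; dilate_ring.
have := congr1 (fps_rescale (-1)) phim_sqr.
rewrite rmorphXn rmorphB [X in _ - X]rmorphM /= fps_rescaleN1X.
have res2 a : fps_rescale (-1) (V 2 a) = V 2 a := @fps_rescaleN1_dilate 1 a.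
rewrite !res2 mulNr opprK => <-; congr (_ ^+ 2).
by apply: fpsP => n /=; rewrite mulrA -exprMn mulrNN mulr1 expr1n mul1r.
Qed.

(** Compare the odd part of phi^2 in [phi_sqr_2dissection] with the cross term of the squared
    [phi_2dissection]. *)
Lemma psi_sqr : psi ^+ 2 = phi * V 2 psi.
Proof.
apply: (@fps_dilate_inj _ 2) => //; apply: (@fps_mulf_nat_inj 4) => //.
have := phi_sqr_2dissection; rewrite {1}phi_2dissection.
have -> : (V 4 phi + 2%:R * X ^+ 1 * V 8 psi) ^+ 2 =
  V 2 (V 2 phi ^+ 2 + 4%:R * X * V 4 psi ^+ 2) +
  X * V 2 (4%:R * V 2 (phi * V 2 psi)) by dilate_ring.
by move=> /(congr1 (U 2 1)); rewrite !fps_section2_1.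
Qed.

(** These are the exponents 1 mod 3 on both sides of [psi_sqr], up to a factor 2. *)
Lemma penta_mul_psi : penta * V 3 psi = omega * V 2 penta.
Proof.
apply: (@fps_mulf_nat_inj 2) => //.
have := psi_sqr; move=> /(congr1 (U 3 1)).
rewrite [X in U 3 1 (X ^+ 2)]psi_3dissection [X in U 3 1 (X * _)]phi_3dissection.
rewrite [X in V 2 X]psi_3dissection.
have -> : (V 3 penta + X ^+ 1 * V 9 psi) ^+ 2 =
  V 3 (penta ^+ 2) + X * V 3 (2%:R * (penta * V 3 psi)) +
  X ^+ 2 * V 3 (V 3 psi ^+ 2) by dilate_ring.
have -> : (V 9 phi + 2%:R * X ^+ 1 * V 3 omega) * V 2 (V 3 penta + X ^+ 1 * V 9 psi) =
  V 3 (V 3 phi * V 2 penta + 2%:R * X * omega * V 6 psi) +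
  X * V 3 (2%:R * (omega * V 2 penta)) + X ^+ 2 * V 3 (V 3 phi * V 6 psi).
  by dilate_ring.
by rewrite !fps_section3_1.
Qed.

(** * Congruences between power series *)

(** An explicit quotient series reduces most closure properties to [ring]. *)
Definition fps_modeq (m : nat) (a b : fps int) : Prop :=
  exists c : fps int, a = b + m%:R * c.

Lemma fps_modeq_sym m a b : fps_modeq m a b -> fps_modeq m b a.
Proof. by case=> c ->; exists (- c); ring. Qed.

Lemma fps_modeq_trans m a b c :
  fps_modeq m a b -> fps_modeq m b c -> fps_modeq m a c.
Proof. by case=> d -> [e ->]; exists (d + e); ring. Qed.

Lemma fps_modeqM m a b c d :
  fps_modeq m a b -> fps_modeq m c d -> fps_modeq m (a * c) (b * d).
Proof.
case=> e -> [f ->]; exists (b * f + d * e + m%:R * e * f).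
by ring.
Qed.

Lemma fps_modeqMl m k a b :
  fps_modeq m a b -> fps_modeq (k * m) (k%:R * a) (k%:R * b).
Proof. by case=> c ->; exists c; rewrite natrM; ring. Qed.

Lemma fps_modeq_coef (m : nat) (a b : fps int) n :
  fps_modeq m a b -> (a n = b n %[mod m])%Z.
Proof.
case=> c ->; rewrite fps_coefD fps_coef_nat_mul; apply/eqP.
by rewrite eqz_mod_dvd [X in X - _]addrC addrK natz dvdz_mulr.
Qed.

Lemma fps_modeq_coefP (m : nat) (a b : fps int) :
  (forall n, (a n = b n %[mod m])%Z) -> fps_modeq m a b.
Proof.
move=> ab; exists (Fps (fun n => (((a - b) n) %/ m)%Z)).
apply: fpsP => n; rewrite fps_coefD fps_coef_nat_mul /=.
have /eqP := ab n; rewrite eqz_mod_dvd => /divzK def_ab.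
by rewrite natz mulrC def_ab addrC subrK.
Qed.

Lemma fps_modeq1X m (a : fps int) k : fps_modeq m a 1 -> fps_modeq m (a ^+ k) 1.
Proof.
move=> a1; elim: k => [|k IHk]; first by exists 0; rewrite mulr0 addr0.
by rewrite exprS -[X in fps_modeq _ _ X](mulr1 1); apply: fps_modeqM.
Qed.

(** In (1 + mc)^2 = 1 + 2mc + m^2 c^2 the last term is divisible by 2m for even m. Each squaring
    thus doubles the modulus. *)
Lemma fps_modeq_sqr1 m (a : fps int) : ~~ odd m ->
  fps_modeq m a 1 -> fps_modeq (2 * m) (a ^+ 2) 1.
Proof.
move=> m_even [c ->]; exists (c + (m./2)%:R * c ^+ 2).
have : m%:R = 2%:R * (m./2)%:R :> fps int.
  by rewrite -natrM mul2n -[in LHS](odd_double_half m) (negPf m_even).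
by rewrite natrM => ->; ring.
Qed.

(* Strong induction on the degree: for a = b(q^2) + q c(q^2), the claim for a
   follows from the claims for b and c. *)
Lemma fps_sqr_mod2 (a : fps int) : fps_modeq 2 (a ^+ 2) (V 2 a).
Proof.
apply: fps_modeq_coefP => n; apply/eqP; rewrite eqz_mod_dvd.
suff: (2 %| (a ^+ 2 - V 2 a) n)%Z by [].
have [N le_nN] := ubnP n; elim: N => // N IHN in n a le_nN *.
case: n le_nN => [_|n le_nN].
  rewrite fps_coefD fps_coefN expr2 fps_coefM0 fps_coef_dilate div0n dvdn0.
  (* For z = 2q + r with r^2 = r, z^2 - z = 2q(z + r - 1). *)
  move: (a 0%N) => z; apply/dvdzP; exists ((z %/ 2)%Z * (z + (z %% 2)%Z - 1)).
  have := divz_eq z 2; have := ltz_pmod z (isT : 0 < 2 :> int).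
  have := modz_ge0 z (isT : 2 != 0 :> int).
  move: (z %/ 2)%Z (z %% 2)%Z => q r r_ge0 r_lt2 ->.
  have [->|->] : r = 0 \/ r = 1 by lia.
    by ring.
  by ring.
set b := U 2 0 a; set c := U 2 1 a.
have -> : a ^+ 2 - V 2 a =
    V 2 ((b ^+ 2 - V 2 b) + X ^+ 1 * (c ^+ 2 - V 2 c)) + 2%:R * (X * V 2 (b * c)).
  rewrite [X in V 2 X](fps_dissection2 a) {1}(fps_dissection2 a) -/b -/c.
  by dilate_ring.
rewrite fps_coefD fps_coef_nat_mul rpredD //; last first.
  by rewrite natz dvdz_mulr.
rewrite fps_coef_dilate.
case: ifP => // n_even; rewrite fps_coefD fps_coefXnM rpredD // ?IHN //; first by lia.
by case: ifP => // n_gt0; apply: IHN; lia.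
Qed.

Lemma phi_mod2 : fps_modeq 2 phi 1.
Proof.
apply: fps_modeq_coefP => -[|n] //=; case: ifP => // _; exact: modzz.
Qed.

Lemma phim_mod2 : fps_modeq 2 phim 1.
Proof.
have [s def_s] := phi_mod2; exists (fps_rescale (-1) s).
by rewrite {1}def_s rmorphD rmorphM rmorph1 rmorph_nat.
Qed.

Lemma fps_modeq_dilate m k a b : fps_modeq m a b -> fps_modeq m (V k a) (V k b).
Proof. by case=> c ->; exists (V k c); rewrite rmorphD rmorphM rmorph_nat. Qed.

Lemma fps_modeq_dilate1 m k a : fps_modeq m a 1 -> fps_modeq m (V k a) 1.
Proof. by move=> /(fps_modeq_dilate k); rewrite rmorph1. Qed.

Lemma fps_modeq1M m a b :
  fps_modeq m a 1 -> fps_modeq m b 1 -> fps_modeq m (a * b) 1.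
Proof. by rewrite -{3}(mulr1 1); apply: fps_modeqM. Qed.

Lemma fps_modeq_cancel m a b : fps_modeq m b 1 -> fps_modeq m (a * b) a.
Proof. by case=> c ->; exists (a * c); ring. Qed.

Lemma phim_unit : phim \is a GRing.unit.
Proof. by rewrite fps_unitE /= mul1r unitr1. Qed.

Lemma schur9_series_mod2 : fps_modeq 2 schur9_series 1.
Proof.
have n2 := phim_mod2; have Vn k := fps_modeq_dilate1 k n2.
apply: fps_modeq_trans (fps_modeq_sym (fps_modeq_cancel _ n2)) _.
apply: fps_modeq_trans (fps_modeq_sym (fps_modeq_cancel _ (Vn 18%N))) _.
by rewrite schur9_series_phim; apply: fps_modeq1M.
Qed.

Lemma schur9_series_pow16 : fps_modeq 32 (schur9_series ^+ 16) 1.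
Proof.
have e4 := @fps_modeq_sqr1 2 _ isT schur9_series_mod2.
have e8 := @fps_modeq_sqr1 4 _ isT e4; have e16 := @fps_modeq_sqr1 8 _ isT e8.
by have := @fps_modeq_sqr1 16 _ isT e16; rewrite -!exprM.
Qed.

(** * Dissection of the generating series *)

(** The generating series is rewritten over a denominator in q^2, which passes through the section;
    the odd part of phi(q) phi(-q^9) remains. *)
Lemma schur9_section2_1 :
  U 2 1 schur9_series * phim * V 9 phim =
  2%:R * V 2 (V 2 psi * V 9 phi - X ^+ 2 * phi * V 18 psi).
Proof.
have phi_form : schur9_series * V 2 (phim * V 9 phim) = phi * V 9 phim.
  have unit2 : V 2 phim \is a GRing.unit by apply: rmorph_unit phim_unit.
  apply: (mulrI unit2).
  transitivity (schur9_series * V 18 phim * V 2 phim ^+ 2); first by dilate_ring.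
  rewrite -phi_mul_phim.
  transitivity (phi * (schur9_series * phim * V 18 phim)); first by ring.
  by rewrite schur9_series_phim; ring.
have := congr1 (U 2 1) phi_form.
rewrite mulrC fps_section_dilateM // => def_U.
rewrite -mulrA mulrC def_U phim_2dissection [X in U 2 1 (X * _)]phi_2dissection.
(* The supplied series is the even part of phi(q) phi(-q^9). *)
rewrite -[RHS](fps_section2_1 (V 2 phi * V 18 phi - 4%:R * X ^+ 5 * V 4 psi * V 36 psi)).
by congr (U 2 1 _); dilate_ring.
Qed.

(** Multiplying by phi(q) phi(q^9) again makes the denominator even; the factor already in q^2 is
    pulled out, and the odd part of phi(q) phi(q^9) supplies another factor 2. *)
Lemma schur9_section4_3 :
  U 2 1 (U 2 1 schur9_series) * phim ^+ 2 * V 9 phim ^+ 2 =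
  4%:R * (V 2 psi * V 9 phi - X ^+ 2 * phi * V 18 psi) *
    V 2 (V 2 psi * V 9 phi + X ^+ 2 * phi * V 18 psi).
Proof.
set C := V 2 psi * V 9 phi - X ^+ 2 * phi * V 18 psi.
set D := V 2 psi * V 9 phi + X ^+ 2 * phi * V 18 psi.
have eqn : V 2 (phim ^+ 2 * V 9 phim ^+ 2) * U 2 1 schur9_series =
    V 2 C * (2%:R * phi * V 9 phi).
  transitivity (2%:R * V 2 C * (phi * V 9 phi)); last by ring.
  rewrite -schur9_section2_1 rmorphM rmorphXn /= -phi_mul_phim.
  have -> : V 2 (V 9 phim ^+ 2) = V 9 phi * V 9 phim.
    by rewrite -rmorphM phi_mul_phim; dilate_ring.
  by ring.
have := congr1 (U 2 1) eqn; rewrite !fps_section_dilateM // => def_U.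
rewrite -mulrA mulrC def_U; transitivity (C * (4%:R * V 2 D)); last by ring.
congr (C * _).
have -> : 2%:R * phi * V 9 phi =
    V 2 (2%:R * (V 2 phi * V 18 phi + 4%:R * X ^+ 5 * V 4 psi * V 36 psi)) +
    X * V 2 (4%:R * V 2 D).
  by rewrite [in LHS]phi_2dissection /D; dilate_ring.
by rewrite fps_section2_1.
Qed.

Lemma fps_modeq_section m k r a b :
  fps_modeq m a b -> fps_modeq m (U k r a) (U k r b).
Proof.
by case=> c ->; exists (U k r c); rewrite raddfD !mulr_natl raddfMn.
Qed.

(** After multiplication by P = phi(q)^2 phi(q^9)^2 the denominator is even. The odd parts of C and
    P carry factors 2 and 4, so their product only matters beyond 4 * 8 = 32. *)
Lemma schur9_section8_3 :
  fps_modeq 32 (U 2 0 (U 2 1 (U 2 1 schur9_series)))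
    (4%:R * ((V 2 psi * V 9 phi + X ^+ 2 * phi * V 18 psi) *
             (psi * V 18 phi - X * V 9 psi * V 2 phi) *
             (phi ^+ 2 * V 9 phi ^+ 2))).
Proof.
set C := V 2 psi * V 9 phi - X ^+ 2 * phi * V 18 psi.
set D := V 2 psi * V 9 phi + X ^+ 2 * phi * V 18 psi.
set H2 := U 2 1 (U 2 1 schur9_series).
set P := phi ^+ 2 * V 9 phi ^+ 2; set C0 := psi * V 18 phi - X * V 9 psi * V 2 phi.
have eqn : V 2 (phim ^+ 4 * V 9 phim ^+ 4) * H2 = V 2 D * (4%:R * (C * P)).
  transitivity (4%:R * C * V 2 D * P); last by ring.
  rewrite -schur9_section4_3 -/H2 /P.
  transitivity (H2 * (V 2 phim ^+ 2) ^+ 2 * V 9 (V 2 phim ^+ 2) ^+ 2).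
    by dilate_ring.
  by rewrite -phi_mul_phim; dilate_ring.
have := congr1 (U 2 0) eqn; rewrite !fps_section_dilateM // => def_U.
pose Z := V 2 psi ^+ 2 * V 9 phi ^+ 2 + X ^+ 4 * phi ^+ 2 * V 18 psi ^+ 2.
have P_form : P = V 2 (P + 16%:R * X ^+ 5 * V 2 psi ^+ 2 * V 18 psi ^+ 2) +
    X * V 2 (4%:R * Z).
  transitivity ((V 2 (phi ^+ 2) + X * V 2 (4%:R * V 2 (psi ^+ 2))) *
      V 9 (V 2 (phi ^+ 2) + X * V 2 (4%:R * V 2 (psi ^+ 2)))).
    by rewrite -phi_sqr_2dissection rmorphXn.
  by rewrite /P /Z; dilate_ring.
pose C1 := X ^+ 4 * psi * V 36 psi - X * V 9 psi * V 4 psi.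
have C_form : C = V 2 C0 + X * V 2 (2%:R * C1).
  transitivity (V 2 psi * V 9 (V 4 phi + 2%:R * X ^+ 1 * V 8 psi) -
      X ^+ 2 * (V 4 phi + 2%:R * X ^+ 1 * V 8 psi) * V 18 psi).
    by rewrite -phi_2dissection.
  by rewrite /C0 /C1; dilate_ring.
have CP_form : exists W, U 2 0 (4%:R * (C * P)) = 4%:R * (C0 * P + 8%:R * W).
  (* The first term comes from the two odd parts, the second from the 16 in the even part of P. *)
  exists (X * C1 * Z + 2%:R * C0 * X ^+ 5 * V 2 psi ^+ 2 * V 18 psi ^+ 2).
  rewrite P_form C_form; set P' := P + _; set Z' := 4%:R * Z; set C1' := 2%:R * C1.
  have -> : 4%:R * ((V 2 C0 + X * V 2 C1') * (V 2 P' + X * V 2 Z')) =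
      V 2 (4%:R * (C0 * P' + X * C1' * Z')) +
      X * V 2 (4%:R * (C0 * Z' + C1' * P')).
    by clearbody P' Z' C1' C0; dilate_ring.
  by rewrite fps_section2_0 /P' /Z' /C1' -P_form; ring.
case: CP_form def_U => W -> def_U.
set u := phim ^+ 4 * V 9 phim ^+ 4.
have u8 : fps_modeq 8 u 1.
  have phim8 : fps_modeq 8 (phim ^+ 4) 1.
    have n4 := @fps_modeq_sqr1 2 _ isT phim_mod2.
    by have := @fps_modeq_sqr1 4 _ isT n4; rewrite -exprM.
  have -> : u = phim ^+ 4 * V 9 (phim ^+ 4) by rewrite rmorphXn.
  by apply: fps_modeq1M => //; apply: fps_modeq_dilate1.
have u32 : fps_modeq 32 (u ^+ 4) 1.
  have u16 := @fps_modeq_sqr1 8 _ isT u8.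
  by have := @fps_modeq_sqr1 16 _ isT u16; rewrite -exprM.
(* Inserting u^4 = 1 mod 32 avoids dividing by u: one factor u is absorbed by [def_U], and u^3 is
   dropped mod 8 under the prefactor 4. *)
apply: fps_modeq_trans (fps_modeq_sym (fps_modeq_cancel _ u32)) _.
have -> : U 2 0 H2 * u ^+ 4 =
    4%:R * (D * C0 * P * u ^+ 3 + 8%:R * (D * W * u ^+ 3)).
  transitivity (u * U 2 0 H2 * u ^+ 3); first by ring.
  by rewrite /u def_U -/u; ring.
apply: (@fps_modeqMl 8 4).
apply: (@fps_modeq_trans _ _ (D * C0 * P * u ^+ 3)).
  by exists (D * W * u ^+ 3).
by apply: fps_modeq_cancel; apply: fps_modeq1X.
Qed.

(** The part 1 mod 3 of the preceding expression is exactly 16 B. Modulo 2, B reduces to penta(q)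
    penta(q^2) omega(q), and [penta_mul_psi] with penta(q)^2 = penta(q^2) finishes. *)
Lemma schur9_section24_11 :
  fps_modeq 32 (U 24 11 schur9_series) (16%:R * (V 2 penta * V 3 psi)).
Proof.
have -> : U 24 11 schur9_series =
    U 3 1 (U 2 0 (U 2 1 (U 2 1 schur9_series))).
  by rewrite !fps_section_comp.
apply: fps_modeq_trans (fps_modeq_section 3 1 schur9_section8_3) _.
set a := V 3 phi; set b := V 6 phi.
pose B := (b * penta - 2%:R * X * V 3 psi * V 2 omega) * a ^+ 3 *
  ((a * V 2 penta + 2%:R * X * V 6 psi * omega) * omega +
   2%:R * X * V 6 psi * omega ^+ 2).
have -> : U 3 1 (4%:R * ((V 2 psi * V 9 phi + X ^+ 2 * phi * V 18 psi) *
             (psi * V 18 phi - X * V 9 psi * V 2 phi) *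
             (phi ^+ 2 * V 9 phi ^+ 2))) = 16%:R * B.
  pose p := V 9 phi + 2%:R * X ^+ 1 * V 3 omega.
  pose s := V 3 penta + X ^+ 1 * V 9 psi.
  have -> : 4%:R * ((V 2 psi * V 9 phi + X ^+ 2 * phi * V 18 psi) *
             (psi * V 18 phi - X * V 9 psi * V 2 phi) *
             (phi ^+ 2 * V 9 phi ^+ 2)) =
      4%:R * ((V 2 s * V 9 phi + X ^+ 2 * p * V 18 psi) *
             (s * V 18 phi - X * V 9 psi * V 2 p) *
             (p ^+ 2 * V 9 phi ^+ 2)).
    by rewrite /s /p -psi_3dissection -phi_3dissection.
  (* The second factor is V 3 C0, because its terms q psi(q^9) phi(q^18) cancel; the first is V 3 D0
     + q^2 V 3 D2. *)
  pose C0 := b * penta - 2%:R * X * V 3 psi * V 2 omega.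
  pose D0 := a * V 2 penta + 2%:R * X * V 6 psi * omega.
  pose D2 := 2%:R * a * V 6 psi.
  rewrite -(fps_section3_1
    (4%:R * C0 * a ^+ 2 * (D0 * a ^+ 2 + X * D2 * (4%:R * a * omega)))
    (16%:R * B)
    (4%:R * C0 * a ^+ 2 * (D0 * (4%:R * omega ^+ 2) + D2 * a ^+ 2))).
  congr (U 3 1 _); rewrite /s /p /C0 /D0 /D2 /B /a /b.
  by dilate_ring.
apply: (@fps_modeqMl 2 16).
apply: (@fps_modeq_trans _ _ (penta * (V 2 penta * omega) * (b * a ^+ 4))).
  pose g := X * V 3 psi * V 2 omega; pose k := X * V 6 psi * omega ^+ 2.
  exists (2%:R * b * penta * a ^+ 3 * k -
    g * a ^+ 3 * (a * V 2 penta * omega + 4%:R * k)).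
  by rewrite /B /g /k; ring.
have a2 : fps_modeq 2 a 1 by apply: fps_modeq_dilate1 phi_mod2.
have b2 : fps_modeq 2 b 1 by apply: fps_modeq_dilate1 phi_mod2.
apply: fps_modeq_trans (fps_modeq_cancel _ _) _.
  by apply: fps_modeq1M => //; apply: fps_modeq1X.
rewrite (mulrC (V 2 penta)) -penta_mul_psi mulrA -expr2.
by apply: fps_modeqM (fps_sqr_mod2 _) _; exists 0; rewrite mulr0 addr0.
Qed.

Lemma schur9_overpartitions_mod32 m M :
  (schur9_overpartitions (16 * m + 1) (24 * M + 11) =
   16 * (V 2 penta * V 3 psi) M %[mod 32])%Z.
Proof.
rewrite schur9_overpartitionsE addn1 exprSr exprM.
have -> : 16 * (V 2 penta * V 3 psi) M = (16%:R * (V 2 penta * V 3 psi)) M.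
  by rewrite fps_coef_nat_mul natz.
rewrite -(fps_modeq_coef M schur9_section24_11) fps_coef_section mulrC.
apply: fps_modeq_coef; apply: fps_modeq_cancel.
by apply: fps_modeq1X; apply: schur9_series_pow16.
Qed.

(** If M = 2i + 3j with 24i + 1 = k^2 and 8j + 1 = l^2, then 24M + 11 = 2(24i + 1) + 9(8j + 1). *)
Lemma penta_mul_psi_support M : (V 2 penta * V 3 psi) M != 0 ->
  exists k l, (24 * M + 11 = 2 * (k * k) + 9 * (l * l))%N.
Proof.
rewrite fps_coefM => nz.
have [[i lt_iM] /= nz_i] : exists i : 'I_M.+1, V 2 penta i * V 3 psi (M - i)%N != 0.
  apply/existsP; apply: contraR nz; rewrite negb_exists => /forallP z.
  by rewrite big1 // => i _; apply/eqP; have := z i; rewrite negbK.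
move: nz_i; rewrite mulf_eq0 negb_or /=.
case: ifP => // /dvdnP[i' def_i]; case: ifP => [/dvdnP[j def_j]|]; last first.
  by rewrite eqxx andbF.
rewrite {1}def_i def_j !mulnK // !pnatr_eq0 !eqb0 !negbK.
case/andP=> /is_squareP[k def_k] /is_squareP[l def_l].
by exists k, l; lia.
Qed.

(** * The form 2x^2 + 9y^2 at an inert prime *)

Lemma legendre_nonsquare p (a : int) (x : 'F_p) : legendre a p = -1 ->
  x ^+ 2 != a%:~R.
Proof.
rewrite /legendre; case: ifP => // _; case: ifP => // /negbT.
by rewrite negb_exists => /forallP.
Qed.

(** If p did not divide l, then 2k/l would be a square root of -18 modulo p. Once p divides l, it
    divides 2k^2, hence k. *)
Lemma inert_dvdn p k l : prime p -> (5 <= p)%N -> legendre (-18) p = -1 ->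
  (p %| 2 * (k * k) + 9 * (l * l))%N -> (p %| k)%N && (p %| l)%N.
Proof.
move=> p_prime p_ge5 leg p_dvd.
have natF n : ((n%:R : 'F_p) == 0) = (p %| n)%N.
  by rewrite -(dvdn_pcharf (pchar_Fp p_prime)).
have form0 : (2 * k%:R ^+ 2 + 9 * l%:R ^+ 2 : 'F_p) = 0.
  by apply/eqP; rewrite !expr2 -!natrM -natrD natF.
have p_dvd_l : (p %| l)%N.
  rewrite -natF; apply: contraT => l_neq0.
  have := legendre_nonsquare (2 * k%:R / l%:R) leg; case/negP; apply/eqP.
  apply: (mulIf (expf_neq0 2 l_neq0)); rewrite exprMn exprVn divfK ?expf_neq0 //.
  transitivity (2 * (2 * k%:R ^+ 2 + 9 * l%:R ^+ 2) - 18 * l%:R ^+ 2 : 'F_p).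
    by ring.
  by rewrite form0; ring.
rewrite p_dvd_l andbT.
move: p_dvd; rewrite dvdn_addl; last by rewrite !dvdn_mull.
rewrite !Euclid_dvdM // orbb => /orP[|//] /(dvdn_leq (isT : 0 < 2)%N).
by rewrite leqNgt; move: p_ge5; case: (ltnP 2 p) => //; lia.
Qed.

(** Descent: p divides both variables, so p^2 can be divided out, lowering a by one. At a = 0 this
    would force p to divide u. *)
Lemma inert_form_neq p k l a u : prime p -> (5 <= p)%N ->
  legendre (-18) p = -1 -> ~~ (p %| u)%N ->
  (2 * (k * k) + 9 * (l * l) != p ^ (2 * a + 1) * u)%N.
Proof.
move=> p_prime p_ge5 leg p_u.
have p_gt0 : (0 < p)%N by apply: prime_gt0.
elim: a k l => [|a IHa] k l; apply/eqP => form.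
all: have /andP[/dvdnP[k' def_k] /dvdnP[l' def_l]] : (p %| k)%N && (p %| l)%N
  by apply: inert_dvdn => //; rewrite form expnD expn1 mulnAC dvdn_mull.
  move/negP: p_u; apply.
  apply/dvdnP; exists (2 * (k' * k') + 9 * (l' * l'))%N.
  apply/eqP; rewrite -(eqn_pmul2l p_gt0); apply/eqP.
  by move: form; rewrite muln0 add0n expn1 => <-; rewrite def_k def_l; ring.
have /negP[] := IHa k' l'.
have pp_gt0 : (0 < p * p)%N by rewrite muln_gt0 p_gt0.
rewrite -(eqn_pmul2l pp_gt0); apply/eqP.
have -> : (p * p * (p ^ (2 * a + 1) * u) = p ^ (2 * a.+1 + 1) * u)%N.
  by rewrite mulnS -addnA !expnS; ring.
by rewrite -form def_k def_l; ring.
Qed.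

Theorem theorem3p6 (p m alpha n i : nat)
    (p_prime : prime p) (p_ge5 : (5 <= p)%N)
    (legendre_p : legendre (-18) p = -1)
    (i_ge1 : (1 <= i)%N) (i_le : (i <= p - 1)%N) :
  (schur9_overpartitions (16 * m + 1)
     (24 * p ^ (2 * alpha + 2) * n
        + (24 * i + 11 * p) * p ^ (2 * alpha + 1)) = 0 %[mod 32])%Z.

Proof.
have p_gt0 : (0 < p)%N by apply: prime_gt0.
have p_odd : odd p by case/even_prime: p_prime p_ge5 => [->|].
(* A prime p >= 5 is coprime to 24, and p^2 is 1 modulo both 3 and 8. *)
have p2_mod24 : exists c, (p * p = 24 * c + 1)%N.
  have not3 : ~~ (3 %| p)%N.
    by apply/negP; rewrite dvdn_prime2 // => /eqP p3; rewrite -p3 in p_ge5.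
  have [c3 def3] : exists c, (p * p = 3 * c + 1)%N.
    have := divn_eq p 3; move: not3; rewrite /dvdn; have := ltn_pmod p (isT : 0 < 3)%N.
    move: (p %/ 3)%N (p %% 3)%N => q [|[|[|//]]] // _ _ ->.
      by exists (3 * q * q + 2 * q)%N; ring.
    by exists (3 * q * q + 4 * q + 1)%N; ring.
  have [c8 def8] : exists c, (p * p = 8 * c + 1)%N.
    have [h def_p] : exists h, p = (2 * h + 1)%N.
      by exists p./2; have := odd_double_half p; rewrite p_odd; lia.
    have h_even : ~~ odd (h * h.+1) by rewrite oddM /=; case: (odd h).
    exists (h * h.+1)./2; have := odd_double_half (h * h.+1).
    by rewrite (negPf h_even) def_p; lia.
  by exists (p * p %/ 24)%N; lia.
have [c def_pp] : exists c, (p ^ (2 * alpha + 2) = 24 * c + 1)%N.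
  case: p2_mod24 => d def_d; elim: (alpha) => [|a [c def_c]].
    by exists d; rewrite muln0 add0n -mulnn.
  exists (p * p * c + d)%N; rewrite mulnS -addnA expnD def_c -mulnn.
  by rewrite mulnDr muln1 {2}def_d; ring.
(* Modulo 24 only 11 p^(2 alpha + 2) remains, which is 11. *)
have [M def_N] : exists M, (24 * p ^ (2 * alpha + 2) * n
    + (24 * i + 11 * p) * p ^ (2 * alpha + 1) = 24 * M + 11)%N.
  have : (p * p ^ (2 * alpha + 1) = 24 * c + 1)%N.
    by rewrite -def_pp -expnS; congr (p ^ _)%N; lia.
  move=> def_c.
  exists (p ^ (2 * alpha + 2) * n + i * p ^ (2 * alpha + 1) + 11 * c)%N.
  by rewrite mulnDl -(mulnA 11 p) def_c; ring.
rewrite def_N schur9_overpartitions_mod32.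
have [->|] := eqVneq ((fps_dilate 2 theta_penta * fps_dilate 3 theta_psi) M) 0.
  by rewrite mulr0.
case/penta_mul_psi_support=> k [l].
rewrite -def_N => form.
(* This cofactor of p^(2 alpha + 1) in the argument is 24i modulo p, nonzero because 0 < i < p. *)
have p_u : ~~ (p %| 24 * (p * n + i) + 11 * p)%N.
  rewrite dvdn_addl; last by rewrite dvdn_mull.
  rewrite Euclid_dvdM // negb_or; apply/andP; split.
    rewrite (_ : 24 = 2 ^ 3 * 3)%N // Euclid_dvdM // Euclid_dvdX // andbT.
    by rewrite !dvdn_prime2 //; lia.
  by rewrite dvdn_addr ?dvdn_mulr // gtnNdvd //; lia.
case/negP: (inert_form_neq k l alpha p_prime p_ge5 legendre_p p_u).
rewrite -form; apply/eqP; have -> : (2 * alpha + 2 = (2 * alpha + 1).+1)%N by lia.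
by rewrite expnS; ring.
Qed.
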